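(* Every well-founded extensive game with perfect information with finitely many outcomes (i.e. such that the set $\{(p_1(z),\ldots,p_n(z)) \mid z \text{ a leaf of the game tree}\}$ is finite) has a subgame perfect equilibrium.
   Context: An extensive game with perfect information for $n\ge 1$ players is $G=(T,\mathit{turn},p_1,\ldots,p_n)$, where $T=(V,E)$ is a (possibly infinite, possibly infinitely branching) rooted tree with edges directed away from the root and set of leaves $Z$, $\mathit{turn}:V\setminus Z\to\{1,\ldots,n\}$ says who moves at each non-leaf node, and $p_i:Z\to\mathbb{R}$ is the payoff function of player $i$. The game is well-founded if $T$ has no infinite paths. A strategy of player $i$ is a function $s_i$ assigning to each non-leaf node $u$ with $\mathit{turn}(u)=i$ a child of $u$; $S_i$ is the set of these strategies. A joint strategy is $s=(s_1,\ldots,s_n)\in S_1\times\cdots\times S_n$; $s_{-i}$ denotes $(s_j)_{j\neq i}$. In a well-founded game, following $s$ from the root leads to a unique leaf, denoted $\mathit{leaf}(s)$; the outcome of $s$ is $(p_1(\mathit{leaf}(s)),\ldots,p_n(\mathit{leaf}(s)))$. A joint strategy $s$ is a Nash equilibrium if for all players $i$ and all $s'_i\in S_i$, $p_i(\mathit{leaf}(s_i,s_{-i}))\ge p_i(\mathit{leaf}(s'_i,s_{-i}))$. For a node $w$, the subgame $G^w$ has the same players, the subtree $T^w$ of $T$ rooted at $w$, and the restrictions of $\mathit{turn}$ and the payoff functions to $T^w$; $s^w$ is the restriction of $s$ to $G^w$. A joint strategy $s$ is a subgame perfect equilibrium of $G$ if for every node $w$ of $T$, $s^w$ is a Nash equilibrium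 in $G^w$. *)

(* Defs.v *)
(* Extensive games with perfect information on arbitrary (possibly infinite,
   possibly infinitely branching) rooted trees. *)
From mathcomp Require Import all_boot all_order all_algebra.
From mathcomp Require Import boolp classical_sets cardinality reals.

Set Implicit Arguments.
Unset Strict Implicit.
Unset Printing Implicit Defensive.

Import Order.TTheory GRing.Theory Num.Theory.

Local Open Scope ring_scope.

Section Trees.
Variable V : Type.
Implicit Types (E : rel V) (r u v : V).

Definition is_leaf E u : Prop := forall v, ~~ E u v.

(* [p] lists the nodes after [u] on a directed walk from [u] to [v]. *)
Definition is_walk E u v (p : seq V) : Prop := path E u p /\ last u p = v.

Definition descendant E u v : Prop := exists p, is_walk E u v p.

(* Uniqueness is required among all directed walks, not only simple ones: this
   excludes edges into the root, self-loops and cycles. *)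
Definition rooted_tree E r : Prop := forall v, exists! p, is_walk E r v p.

Definition no_infinite_path E : Prop :=
  ~ exists f : nat -> V, forall k, E (f k) (f k.+1).

End Trees.

Record game (R : realType) (n : nat) := Game {
  node : Type;
  root : node;
  edge : rel node;
  tree : rooted_tree edge root;
  turn : {u : node | ~ is_leaf edge u} -> 'I_n;
  payoff : 'I_n -> {z : node | is_leaf edge z} -> R
}.

Arguments turn {R n} g _.
Arguments payoff {R n} g _ _.

Section Games.
Variables (R : realType) (n : nat).
Implicit Types G : game R n.

Definition inner G := {u : node G | ~ is_leaf (@edge _ _ G) u}.
Definition leaf G := {z : node G | is_leaf (@edge _ _ G) z}.
Definition child G (u : node G) := {v : node G | edge u v}.

Definition well_founded_game G : Prop := no_infinite_path (@edge _ _ G).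

Definition outcome G (z : leaf G) : n.-tuple R := [tuple payoff G i z | i < n].

Definition outcomes G : set (n.-tuple R) := range (@outcome G).

Definition strategy G (i : 'I_n) :=
  forall u : inner G, turn G u = i -> child (sval u).

Definition joint_strategy G := forall i : 'I_n, strategy G i.

Definition move G (s : joint_strategy G) (u : inner G) : node G :=
  sval (s (turn G u) u erefl).

(* [v] is the node at depth [k] on the path obtained by following [s]. *)
Fixpoint play_at G (s : joint_strategy G) (k : nat) (v : node G) : Prop :=
  if k is k'.+1 then exists2 u : inner G, play_at s k' (sval u) & v = move s u
  else v = root G.

Definition ends_at G (s : joint_strategy G) (z : leaf G) : Prop :=
  exists k, play_at s k (sval z).

Lemma ends_at_exists G (s : joint_strategy G) :
  well_founded_game G -> exists z, ends_at s z.
Proof.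
move=> wf; apply: contrapT => noleaf; apply: wf.
pose S := {v : node G | exists k, play_at s k v}.
have inn (x : S) : ~ is_leaf (@edge _ _ G) (sval x).
  by move=> lf; apply: noleaf; exists (exist _ (sval x) lf); exact: (svalP x).
have nextP (x : S) : exists k, play_at s k (move s (exist _ (sval x) (inn x))).
  by have [k hk] := svalP x; exists k.+1; exists (exist _ (sval x) (inn x)).
pose next (x : S) : S := exist _ _ (nextP x).
have r0 : exists k, play_at s k (root G) by exists 0%N.
exists (fun k => sval (iter k next (exist _ _ r0))) => k.
rewrite iterS; move: (iter k next _) => x.
exact: (svalP (s _ (exist _ (sval x) (inn x)) erefl)).
Qed.

Lemma play_at_inj G (s : joint_strategy G) k (u v : node G) :
  play_at s k u -> play_at s k v -> u = v.
Proof.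
elim: k u v => [|k IH] u v /=; first by move=> -> ->.
move=> [[a na] ha ->] [[b nb] hb ->].
have ab : a = b := IH _ _ ha hb; subst b.
by rewrite (Prop_irrelevance na nb).
Qed.

Lemma play_at_le G (s : joint_strategy G) j k (v : node G) :
  (j <= k)%N -> play_at s k v -> exists u, play_at s j u.
Proof.
elim: k v => [|k IH] v; first by rewrite leqn0 => /eqP ->; exists v.
rewrite leq_eqVlt => /orP[/eqP -> hv|]; first by exists v.
by rewrite ltnS => jk /= [u hu _]; exact: IH jk hu.
Qed.

Lemma ends_at_unique G (s : joint_strategy G) (y z : leaf G) :
  ends_at s y -> ends_at s z -> y = z.
Proof.
have stop (a b : leaf G) j k :
    play_at s j (sval a) -> play_at s k (sval b) -> (k <= j)%N.
  move=> ha hb; rewrite leqNgt; apply/negP => jk.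
  have [_ [u hu _]] := play_at_le jk hb.
  by apply: (svalP u); rewrite -(play_at_inj ha hu); exact: (svalP a).
move=> [j hj] [k hk].
have jk : j = k by apply/eqP; rewrite eqn_leq (stop _ _ _ _ hj hk) (stop _ _ _ _ hk hj).
subst k; case: y hj => y ly /= hy; case: z hk => z lz /= hz.
have yz := play_at_inj hy hz; subst z.
by rewrite (Prop_irrelevance ly lz).
Qed.

Definition leaf_of G (wf : well_founded_game G) (s : joint_strategy G) :
  leaf G := projT1 (cid (ends_at_exists s wf)).

Lemma leaf_ofP G (wf : well_founded_game G) (s : joint_strategy G) :
  ends_at s (leaf_of wf s).
Proof. exact: (projT2 (cid (ends_at_exists s wf))). Qed.

(* [dfwith s s'] is the joint strategy (s'_i, s_{-i}). *)
Definition nash_equilibrium G (wf : well_founded_game G)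
    (s : joint_strategy G) : Prop :=
  forall (i : 'I_n) (s' : strategy G i),
    payoff G i (leaf_of wf s) >= payoff G i (leaf_of wf (dfwith s s')).

End Games.

Section Subgames.
Variables (R : realType) (n : nat) (G : game R n) (w : node G).

Definition sub_node := {v : node G | descendant (@edge _ _ G) w v}.

Definition sub_edge : rel sub_node := fun u v => edge (sval u) (sval v).

Lemma descendant_refl : descendant (@edge _ _ G) w w.
Proof. by exists [::]. Qed.

Definition sub_root : sub_node := exist _ w descendant_refl.

Lemma descendant_child (u : sub_node) (v : node G) :
  edge (sval u) v -> descendant (@edge _ _ G) w v.
Proof.
have [p [hp lp]] := svalP u => uv.
by exists (rcons p v); split; rewrite ?last_rcons // rcons_path hp lp.
Qed.

Definition sub_child (u : sub_node) (c : child (sval u)) : sub_node :=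
  exist _ (sval c) (descendant_child (svalP c)).

Lemma sub_leafE (u : sub_node) :
  is_leaf sub_edge u <-> is_leaf (@edge _ _ G) (sval u).
Proof.
split=> lf v; last exact: lf.
apply/negP => uv; have := lf (sub_child (exist _ v uv)).
by rewrite /sub_edge /= uv.
Qed.

Lemma sub_val_inj : injective (fun u : sub_node => sval u).
Proof.
move=> [u hu] [v hv] /= uv; subst v.
by rewrite (Prop_irrelevance hu hv).
Qed.

Lemma sub_walk_lift (u : sub_node) (p : seq (node G)) :
  path (@edge _ _ G) (sval u) p ->
  exists2 q, path sub_edge u q & map (fun x => sval x) q = p.
Proof.
elim: p u => [|v p IH] u; first by exists [::].
move=> /= /andP[uv hp].
have [q hq <-] := IH (sub_child (exist _ v uv)) hp.
by exists (sub_child (exist _ v uv) :: q) => //=; rewrite hq andbT.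
Qed.

Lemma sub_walk_val (u : sub_node) (q : seq sub_node) :
  path sub_edge u q ->
  path (@edge _ _ G) (sval u) (map (fun x => sval x) q).
Proof. by rewrite path_map. Qed.

Lemma sub_tree : rooted_tree sub_edge sub_root.
Proof.
move=> v; have [p [hp lp]] := svalP v.
have [q hq qp] := @sub_walk_lift sub_root p hp.
have lq : last sub_root q = v.
  apply: sub_val_inj.
  by rewrite -lp -qp -[w]/(sval sub_root) (last_map (fun x => sval x)).
exists q; split=> // q' [hq' lq'].
have [r [[hr lr] _]] := tree w.
have [t [_ tU]] := tree (sval v).
have walk (a : seq sub_node) : path sub_edge sub_root a ->
    last sub_root a = v ->
    is_walk (@edge _ _ G) (root G) (sval v) (r ++ map (fun x => sval x) a).
  move=> ha la; split.
    by rewrite cat_path hr lr; exact: (sub_walk_val ha).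
  by rewrite last_cat lr -[w]/(sval sub_root) (last_map (fun x => sval x)) la.
have catI (a b c : seq (node G)) : a ++ b = a ++ c -> b = c.
  by elim: a => //= x a IH [].
apply: (inj_map sub_val_inj); apply: (catI r).
by rewrite -(tU _ (walk _ hq lq)) -(tU _ (walk _ hq' lq')).
Qed.

Definition sub_inner (u : {u : sub_node | ~ is_leaf sub_edge u}) : inner G :=
  exist (fun v => ~ is_leaf (@edge _ _ G) v) (sval (sval u))
    (fun lf => svalP u ((sub_leafE _).2 lf)).

Definition sub_leaf (z : {z : sub_node | is_leaf sub_edge z}) : leaf G :=
  exist (fun v => is_leaf (@edge _ _ G) v) (sval (sval z)) ((sub_leafE _).1 (svalP z)).

Definition subgame : game R n :=
  @Game R n sub_node sub_root sub_edge sub_tree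
    (fun u => turn G (sub_inner u))
    (fun i z => payoff G i (sub_leaf z)).

Lemma subgame_wf : well_founded_game G -> well_founded_game subgame.
Proof. by move=> wf [f hf]; apply: wf; exists (fun k => sval (f k)). Qed.

Definition restrict (s : joint_strategy G) : joint_strategy subgame :=
  fun i u hu => let c := s i (sub_inner u) hu in
    exist (fun v => sub_edge (sval u) v) (@sub_child (sval u) c) (svalP c).

End Subgames.

Arguments subgame_wf {R n G} w _.
Arguments restrict {R n G} w s.

Definition subgame_perfect (R : realType) (n : nat) (G : game R n)
    (wf : well_founded_game G) (s : joint_strategy G) : Prop :=
  forall w : node G, nash_equilibrium (subgame_wf w wf) (restrict w s).

(* Main.v *)
(* Backward induction.  Well-founded recursion along the edges assigns to each
   node the leaf reached from it by optimal play: with finitely many outcomes,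
   the player to move has a child whose leaf maximizes his payoff, although
   there may be infinitely many children.  The strategy choosing these children
   keeps the assigned leaf constant along a play, while a deviation of player i
   can only lower i's payoff at the assigned leaf from one node to the next. *)
Require Import Defs.
From mathcomp Require Import all_boot all_order all_algebra.
From mathcomp Require Import boolp classical_sets cardinality reals.

Set Implicit Arguments.
Unset Strict Implicit.
Unset Printing Implicit Defensive.

Import Order.TTheory.

Local Open Scope ring_scope.

(** A non-accessible node has a non-accessible child, so choosing such children forever would give
    an infinite path. The relation is reversed: children count as smaller. *)
Lemma no_infinite_path_wf (V : Type) (E : rel V) :
  no_infinite_path E -> well_founded (fun v u => E u v).
Proof.
move=> noinf x; apply: contrapT => nx; apply: noinf.
pose S := {y : V | ~ Acc (fun v u => E u v) y}.
have nextP (y : S) : exists z : S, E (sval y) (sval z).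
  apply: contrapT => nz; apply: (svalP y); constructor=> z yz.
  by apply: contrapT => naz; apply: nz; exists (exist _ z naz).
have [next hnext] := choice nextP.
by exists (fun k => sval (iter k next (exist _ x nx))) => k; exact: hnext.
Qed.

(** Recursion whose step is only known to exist: [cid] picks a step function, and extensionality
    lets its fixpoint be unfolded. *)
Lemma wf_choice (A B : Type) (R : A -> A -> Prop)
    (P : forall x, (forall y, R y x -> B) -> B -> Prop) :
  well_founded R -> (forall x rec, exists b, P x rec b) ->
  exists f : A -> B, forall x, P x (fun y _ => f y) (f x).
Proof.
move=> wfR exP; pose F x rec := sval (cid (exP x rec)).
exists (Fix wfR (fun=> B) F) => x; rewrite Fix_eq; first exact: svalP.
by move=> y f g fg; congr F; do 2 apply: functional_extensionality_dep => ?.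
Qed.

Lemma finite_range_max d (A : Type) (T : orderType d) (f : A -> T) (a0 : A) :
  finite_set (range f) -> exists a, forall b, (f b <= f a)%O.
Proof.
move=> /finite_seqP [r rE].
have inr a : f a \in r by have : range f (f a) by [exists a]; rewrite rE.
have [m [mr mmax]] : exists m, m \in r /\ forall x, x \in r -> (x <= m)%O.
  move: (inr a0); elim: r (f a0) {rE inr} => [//|x r IH] _ _.
  case: r IH => [_|y r /(_ y (mem_head _ _)) [m [mr mmax]]].
    by exists x; split=> [|z]; rewrite inE // => /eqP ->.
  case: (leP x m) => xm.
    exists m; split=> [|z]; first by rewrite inE mr orbT.
    by rewrite inE => /predU1P[->//|/mmax].
  exists x; split=> [|z]; first exact: mem_head.
  by rewrite inE => /predU1P[->//|/mmax zm]; exact: le_trans zm (ltW xm).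
have [a _ am] : range f m by rewrite rE.
by exists a => b; rewrite am; exact: mmax.
Qed.

Section BackwardInduction.
Variables (R : realType) (n : nat) (G : game R n).

(** The maximum over the children is expressed by the value at [u] itself, which [c] attains. *)
Definition optimal_child (val : node G -> leaf G) (u : inner G)
    (c : child (sval u)) : Prop :=
  val (sval c) = val (sval u) /\
  forall c' : child (sval u),
    payoff G (turn G u) (val (sval c')) <= payoff G (turn G u) (val (sval u)).

Lemma finite_payoffs (i : 'I_n) :
  finite_set (outcomes G) -> finite_set (range (payoff G i)).
Proof.
move=> /(finite_image (fun t => tnth t i)); apply: sub_finite_set => _ [z _ <-].
by exists (outcome z); [exists z | rewrite tnth_mktuple].
Qed.

Lemma backward_induction :
  well_founded_game G -> finite_set (outcomes G) ->
  exists val : node G -> leaf G,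
    (forall z : leaf G, val (sval z) = z) /\
    forall u : inner G, exists c : child (sval u), optimal_child val c.
Proof.
move=> /no_infinite_path_wf wf fin.
pose P u (rec : forall v, edge u v -> leaf G) (l : leaf G) :=
  (forall lf : is_leaf (@edge _ _ G) u, l = exist _ u lf) /\
  forall nl : ~ is_leaf (@edge _ _ G) u,
    let i := turn G (exist _ u nl) in
    exists c : child u, rec (sval c) (svalP c) = l /\
      forall c' : child u,
        payoff G i (rec (sval c') (svalP c')) <= payoff G i l.
have [|val valP] := wf_choice (P := P) wf.
  move=> u rec; have [lf|nl] := pselect (is_leaf (@edge _ _ G) u).
    exists (exist _ u lf); split=> [lf'|//].
    by rewrite (Prop_irrelevance lf lf').
  (* A non-leaf has a child, so the maximum below is over a nonempty set. *)
  have [c0] : exists c : child u, True.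
    by apply: contrapT => nc; apply: nl => v; apply/negP => uv;
      apply: nc; exists (exist _ v uv).
  pose i := turn G (exist _ u nl).
  pose f (c : child u) := payoff G i (rec (sval c) (svalP c)).
  have [] := @finite_range_max _ _ _ f c0.
    apply: sub_finite_set (finite_payoffs i fin) => _ [c _ <-].
    by exists (rec (sval c) (svalP c)).
  move=> c cmax _; exists (rec (sval c) (svalP c)); split=> // nl' /=.
  by rewrite (Prop_irrelevance nl' nl); exists c; split.
exists val; split=> [[z lz]|[u nu]]; first exact: (valP z).1.
exact: (valP u).2.
Qed.

Section OptimalPlay.
Variables (val : node G -> leaf G) (s : joint_strategy G) (w : node G).
Hypothesis val_leaf : forall z : leaf G, val (sval z) = z.
Hypothesis s_opt : forall i (u : inner G) (hu : turn G u = i),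
  optimal_child val (s hu).

Lemma restrict_leaf z : ends_at (restrict w s) z -> sub_leaf z = val w.
Proof.
(* Writing the leaf as its own value gives a claim meaningful at every node of the play, hence open
   to induction on the depth [k]. *)
move=> [k hk]; rewrite -[LHS]val_leaf /=.
elim: k (sval z) hk => [_ -> //|k IH] _ /= [u hu ->]; rewrite -(IH _ hu).
exact: (s_opt (u := sub_inner u) erefl).1.
Qed.

(** Along the play, moves of the other players follow [s] and keep the value, while moves of [i]
    cannot raise the payoff of [i] at it. *)
Lemma deviation_leaf i (s' : strategy (subgame w) i) z :
  ends_at (dfwith (restrict w s) s') z ->
  payoff G i (sub_leaf z) <= payoff G i (val w).
Proof.
move=> [k hk]; rewrite -[sub_leaf z]val_leaf /=.
elim: k (sval z) hk => [_ -> //|k IH] _ /= [u hu ->].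
apply: le_trans (IH _ hu); rewrite /move.
have [ui|ui] := eqVneq i (turn (subgame w) u); last first.
  rewrite dfwith_out //.
  by rewrite le_eqVlt (s_opt (u := sub_inner u) erefl).1 eqxx.
(* Optimality bounds all children at once, so the child chosen by the deviation stays abstract. *)
set c := (X in sval (sval X)); rewrite [in payoff G i]ui.
exact: ((s_opt (u := sub_inner u) erefl).2 (exist _ (sval (sval c)) (svalP c))).
Qed.

End OptimalPlay.
End BackwardInduction.

Theorem corollary9 (R : realType) (n : nat) (n_gt0 : (0 < n)%N)
    (G : game R n) (wfG : well_founded_game G)
    (finG : finite_set (outcomes G)) :
  exists s : joint_strategy G, subgame_perfect wfG s.
Proof.
have [val [val_leaf valP]] := backward_induction wfG finG.
(* One choice of optimal children serves all subgames, since [val] does not depend on [w]. *)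
pose s : joint_strategy G := fun i u _ => sval (cid (valP u)).
have s_opt i (u : inner G) (hu : turn G u = i) : optimal_child val (s i u hu).
  exact: (svalP (cid (valP u))).
exists s => w i s' /=.
rewrite (restrict_leaf val_leaf s_opt (leaf_ofP _ _)).
exact: (deviation_leaf val_leaf s_opt (leaf_ofP _ _)).
Qed.
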